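(* Let $\varphi$ be a complete Bernstein function of the form $\varphi(x)=\int_0^\infty(1-e^{-sx})\overline\nu(s)\,ds$, with $\overline\nu$ a completely monotone Lévy density, such that $\lim_{\theta\to0}\varphi(\theta)=0$, $\lim_{\theta\to\infty}\varphi(\theta)=+\infty$, $\lim_{\theta\to0}\varphi(\theta)/\theta=+\infty$ and $\lim_{\theta\to\infty}\varphi(\theta)/\theta=0$. Let $\kappa$ be the function with Laplace transform $1/\varphi$ and $\chi(x)=\int_0^x\kappa(z)dz$. Assume that for every $\varepsilon>0$ one has $\kappa\in L^1(0,\varepsilon)\cap L^2(\varepsilon,\infty)$ and $\chi\in L^2(0,\varepsilon)$. Then the process $$B_t^\kappa=\sqrt{C_\kappa}\int_{\mathbb R}\big[\chi((t-u)_+)-\chi((-u)_+)\big]dW_u,\qquad t\ge0,$$ is persistent, i.e. $\rho_n:=\mathbb E\big[B_1^\kappa(B_{n+1}^\kappa-B_n^\kappa)\big]>0$ for all integers $n\ge1$.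
   Context: A Lévy density satisfies $\int_0^\infty(s\wedge1)\overline\nu(s)ds<\infty$. $\kappa:(0,\infty)\to[0,\infty)$ is the (locally integrable, non-increasing) function with $\int_0^\infty e^{-s\theta}\kappa(s)ds=1/\varphi(\theta)$ for $\theta>0$; it exists because $\varphi$ is complete Bernstein, and is the Sonine associate of $\nu(x)=\int_x^\infty\overline\nu(z)dz$. $\chi(x)=0$ for $x\le0$, $(x)_+=\max(x,0)$. $W=(W_u)_{u\in\mathbb R}$ is a two-sided Wiener process, and $C_\kappa=\big(\int_{\mathbb R}[\chi((1-u)_+)-\chi((-u)_+)]^2du\big)^{-1}$ is a normalising constant. Under the stated hypotheses the integrand is in $L^2(\mathbb R)$ for every $t\ge0$. *)

(* Defs.v *)
From HB Require Import structures.
From mathcomp Require Import all_boot all_order all_algebra.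
From mathcomp Require Import all_classical all_reals all_analysis.

Set Implicit Arguments.
Unset Strict Implicit.
Unset Printing Implicit Defensive.

Import Order.TTheory GRing.Theory Num.Theory.
Import numFieldNormedType.Exports.

Local Open Scope classical_set_scope.
Local Open Scope ring_scope.

(* Functions on (0, +oo) are total functions [R -> R]; their values at points
   [x <= 0] are never used. *)

Definition completely_monotone (R : realType) (f : R -> R) : Prop :=
  forall (n : nat) (x : R), 0 < x ->
    derivable (derive1n n f) x 1 /\ 0 <= (-1) ^+ n * derive1n n f x.

Definition levy_density (R : realType) (m : R -> R) : Prop :=
  [/\ measurable_fun (`]0, +oo[ : set R) m,
      (forall s, 0 < s -> 0 <= m s) &
      (\int[lebesgue_measure]_(s in `]0%R, +oo[) (Num.min s 1 * m s)%:E
        < +oo)%E].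

Definition bernstein_integral (R : realType) (m : R -> R) (x : R) : \bar R :=
  (\int[lebesgue_measure]_(s in `]0%R, +oo[) ((1 - expR (- (s * x))) * m s)%:E)%E.

(* Bernstein functions whose Levy measure has a completely monotone density,
   through the Levy-Khintchine representation. *)
Definition complete_bernstein (R : realType) (phi : R -> R) : Prop :=
  exists (a b : R) (m : R -> R),
    [/\ 0 <= a, 0 <= b, levy_density m, completely_monotone m &
        forall x, 0 < x -> (phi x)%:E = ((a + b * x)%:E + bernstein_integral m x)%E].

Definition laplace (R : realType) (f : R -> R) (theta : R) : \bar R :=
  (\int[lebesgue_measure]_(s in `]0%R, +oo[) (expR (- (s * theta)) * f s)%:E)%E.

Definition in_L1 (R : realType) (D : set R) (f : R -> R) : Prop :=
  lebesgue_measure.-integrable D (EFin \o f).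

Definition in_L2 (R : realType) (D : set R) (f : R -> R) : Prop :=
  measurable_fun D f /\
  (\int[lebesgue_measure]_(x in D) ((f x) ^+ 2)%:E < +oo)%E.

(* For [x <= 0] the domain of integration is empty, so [chi kappa x = 0]. *)
Definition chi (R : realType) (kappa : R -> R) (x : R) : R :=
  \int[lebesgue_measure]_(z in `]0, x[) kappa z.

Definition kernel_kappa (R : realType) (kappa : R -> R) (t u : R) : R :=
  chi kappa (Num.max (t - u) 0) - chi kappa (Num.max (- u) 0).

Definition C_kappa (R : realType) (kappa : R -> R) : R :=
  (\int[lebesgue_measure]_(u in [set: R]) (kernel_kappa kappa 1 u) ^+ 2)^-1.

(* The product rule for a subfamily is the case [A i = setT] off it. *)
Definition mutually_independent (d : measure_display) (T : measurableType d)
    (R : realType) (P : probability T R) (n : nat) (X : 'I_n -> T -> R) : Prop :=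
  forall A : 'I_n -> set R, (forall i, measurable (A i)) ->
    P [set w | forall i, A i (X i w)] = (\prod_(i < n) P (X i @^-1` A i))%E.

(* [normal_prob m s] is parametrised by the standard deviation [s], and is not
   a Gaussian law for [s = 0], whence [s < t]. *)
Definition two_sided_wiener (d : measure_display) (T : measurableType d)
    (R : realType) (P : probability T R) (W : R -> {RV P >-> R}) : Prop :=
  [/\ {ae P, forall w, W 0 w = 0},
      (forall (n : nat) (t : nat -> R), (forall i, t i <= t i.+1) ->
         mutually_independent P
           (fun (i : 'I_n) w => W (t i.+1) w - W (t i) w)),
      (forall s t : R, s < t -> forall A : set R, measurable A ->
         P ((fun w => W t w - W s w) @^-1` A) =
         normal_prob 0 (Num.sqrt (t - s)) A) &
      {ae P, forall w, continuous (fun t : R => W t w)}].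

(* The step function [height * 1_(left, right]]. *)
Record step (R : realType) := Step {
  step_height : R;
  step_left : R;
  step_right : R;
  step_le : step_left <= step_right }.

Definition step_fun (R : realType) (s : seq (step R)) (u : R) : R :=
  \sum_(p <- s) step_height p * \1_(`]step_left p, step_right p]) u.

Definition step_integral (R : realType) (T : Type) (W : R -> T -> R)
    (s : seq (step R)) (w : T) : R :=
  \sum_(p <- s) step_height p * (W (step_right p) w - W (step_left p) w).

(* [X] is (a version of) [\int_R f dW]: the value at [f] of the L2-continuous
   extension to [L2(R)] of the integral of step functions. *)
Definition is_wiener_integral (d : measure_display) (T : measurableType d)
    (R : realType) (P : probability T R) (W : R -> {RV P >-> R})
    (f : R -> R) (X : {RV P >-> R}) : Prop :=
  in_L2 [set: R] f /\
  exists s : nat -> seq (step R),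
    ((fun n => \int[lebesgue_measure]_(u in [set: R])
                 ((f u - step_fun (s n) u) ^+ 2)%:E) : nat -> \bar R)%E
       @ \oo --> (0%E : \bar R) /\
    ((fun n => 'E_P[fun w => ((X w - step_integral (fun t => W t) (s n) w) ^+ 2)%R])
       : nat -> \bar R)%E @ \oo --> (0%E : \bar R).

Definition is_B_kappa (d : measure_display) (T : measurableType d)
    (R : realType) (P : probability T R) (W : R -> {RV P >-> R})
    (kappa : R -> R) (B : R -> {RV P >-> R}) : Prop :=
  forall t, 0 <= t -> exists X : {RV P >-> R},
    is_wiener_integral W (kernel_kappa kappa t) X /\
    {ae P, forall w, B t w = Num.sqrt (C_kappa kappa) * X w}.

Definition rho (d : measure_display) (T : measurableType d)
    (R : realType) (P : probability T R) (B : R -> {RV P >-> R}) (n : nat) :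
    \bar R :=
  ('E_P[fun w => (B 1 w * (B n.+1%:R w - B n%:R w))%R])%E.

Definition persistent (d : measure_display) (T : measurableType d)
    (R : realType) (P : probability T R) (B : R -> {RV P >-> R}) : Prop :=
  forall n : nat, (1 <= n)%N -> (0 < rho B n)%E.

(* Main.v *)
(** The Wiener integral is an isometry, so [rho n] equals [C_kappa] times the
    inner product in [L2(R)] of [kernel_kappa 1] and
    [kernel_kappa (n+1) - kernel_kappa n].  As [chi] is nondecreasing, both
    factors are nonnegative, and the product is bounded below by a positive
    constant on [(0, 1/2]] as soon as [kappa] never vanishes.  If the
    nonincreasing function [kappa] vanished somewhere, it would be integrable
    and its Laplace transform [1/phi] would be bounded near [0], contradicting
    [phi -> 0].

    For the isometry, the product of two increments of [W] is a signed sum of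
    squared increments, so only the Gaussian second moment is needed on step
    functions; the general case follows by continuity of the inner product. *)

Require Import Defs.
From HB Require Import structures.
From mathcomp Require Import all_boot all_order all_algebra.
From mathcomp Require Import all_classical all_reals all_analysis.
From mathcomp Require Import measurable_realfun ring lra.
Set Implicit Arguments.
Unset Strict Implicit.
Unset Printing Implicit Defensive.

Import Order.TTheory GRing.Theory Num.Theory.
Import numFieldNormedType.Exports.
Local Open Scope classical_set_scope.
Local Open Scope ring_scope.

(** * Square-integrable functions and the L2 inner product over a measure *)

Section square_integrable_functions.
Context {d : measure_display} {T : measurableType d} {R : realType}.
Variable mu : {measure set T -> \bar R}.
Implicit Types (f g h : T -> R) (a : R).

(** The measure is arbitrary so that one L2 calculus serves both Lebesgue measure and [P]. For
    Lebesgue measure this unfolds to [in_L2 [set: R]]. *)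
Definition square_integrable f : Prop :=
  measurable_fun [set: T] f /\ (\int[mu]_x ((f x) ^+ 2)%:E < +oo)%E.

Definition L2_inner f g : R := \int[mu]_(x in [set: T]) (f x * g x).

Lemma square_integrableP f : square_integrable f <->
  measurable_fun [set: T] f /\ mu.-integrable [set: T] (fun x => ((f x) ^+ 2)%:E).
Proof.
have sqr_abs : (fun x => `|((f x) ^+ 2)%:E|%E) = (fun x => ((f x) ^+ 2)%:E).
  by apply/funext => x; rewrite gee0_abs// lee_fin sqr_ge0.
split=> [[mf foo]|[mf /integrableP[_ foo]]]; split => //.
  apply/integrableP; split; last by rewrite sqr_abs.
  exact/measurable_EFinP/measurable_funX.
by move: foo; rewrite sqr_abs.
Qed.

(** The absolute value of the product is dominated by f^2 + g^2. *)
Lemma square_integrableM f g : square_integrable f -> square_integrable g ->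
  mu.-integrable [set: T] (fun x => (f x * g x)%:E).
Proof.
move=> /square_integrableP[mf If] /square_integrableP[mg Ig].
apply: (@le_integrable _ _ _ mu _ measurableT _
  (fun x => ((f x) ^+ 2)%:E + ((g x) ^+ 2)%:E)%E).
- exact/measurable_EFinP/measurable_funM.
- move=> x _; rewrite -EFinD !abse_EFin lee_fin.
  rewrite [leRHS]ger0_norm ?addr_ge0 ?sqr_ge0//.
  rewrite normrM -(real_normK (num_real (f x))) -(real_normK (num_real (g x))).
  nra.
- exact: integrableD.
Qed.

Lemma square_integrableD f g : square_integrable f -> square_integrable g ->
  square_integrable (fun x => f x + g x).
Proof.
move=> Lf Lg; have Ifg := square_integrableM Lf Lg.
move: (Lf) (Lg) => /square_integrableP[mf If] /square_integrableP[mg Ig].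
apply/square_integrableP; split; first exact: measurable_funD.
rewrite (_ : (fun x => _) = (fun x =>
  ((f x) ^+ 2)%:E + ((g x) ^+ 2)%:E + 2%:E * (f x * g x)%:E)%E); last first.
  by apply/funext => x; rewrite -!EFinM -!EFinD; congr EFin; ring.
by apply: integrableD => //; [exact: integrableD|exact: integrableZl].
Qed.

Lemma square_integrableZ a f : square_integrable f ->
  square_integrable (fun x => a * f x).
Proof.
move=> /square_integrableP[mf If]; apply/square_integrableP; split.
  exact: measurable_funM.
rewrite (_ : (fun x => _) = (fun x => (a ^+ 2)%:E * ((f x) ^+ 2)%:E)%E).
  exact: integrableZl.
by apply/funext => x; rewrite -EFinM exprMn.
Qed.

Lemma square_integrableB f g : square_integrable f -> square_integrable g ->
  square_integrable (fun x => f x - g x).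
Proof.
move=> Lf /(square_integrableZ (-1)) Lg; have := square_integrableD Lf Lg.
by under eq_fun do rewrite mulN1r.
Qed.

Lemma square_integrable0 : square_integrable (fun=> 0).
Proof.
split; first exact: measurable_cst.
by under eq_integral do rewrite expr0n/=; rewrite integral0 ltry.
Qed.

Lemma square_integrable_sum (I : Type) (s : seq I) (F : I -> T -> R) :
  (forall i, square_integrable (F i)) ->
  square_integrable (fun x => \sum_(i <- s) F i x).
Proof.
move=> LF; elim: s => [|i s IHs].
  by under eq_fun do rewrite big_nil; exact: square_integrable0.
by under eq_fun do rewrite big_cons; exact: square_integrableD.
Qed.

Lemma L2_innerC f g : L2_inner f g = L2_inner g f.
Proof. by apply: eq_Rintegral => x _; rewrite mulrC. Qed.

Lemma L2_innerDl f g h : square_integrable f -> square_integrable g ->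
    square_integrable h ->
  L2_inner (fun x => f x + g x) h = L2_inner f h + L2_inner g h.
Proof.
move=> Lf Lg Lh; rewrite /L2_inner -RintegralD//; last 2 first.
- exact: square_integrableM.
- exact: square_integrableM.
by apply: eq_Rintegral => x _; rewrite mulrDl.
Qed.

Lemma L2_innerZl a f h : square_integrable f -> square_integrable h ->
  L2_inner (fun x => a * f x) h = a * L2_inner f h.
Proof.
move=> Lf Lh; rewrite /L2_inner -RintegralZl//; last exact: square_integrableM.
by apply: eq_Rintegral => x _; rewrite mulrA.
Qed.

Lemma L2_innerBl f g h : square_integrable f -> square_integrable g ->
    square_integrable h ->
  L2_inner (fun x => f x - g x) h = L2_inner f h - L2_inner g h.
Proof.
move=> Lf Lg Lh; rewrite /L2_inner -RintegralB//; last 2 first.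
- exact: square_integrableM.
- exact: square_integrableM.
by apply: eq_Rintegral => x _; rewrite mulrBl.
Qed.

Lemma L2_innerBr f g h : square_integrable f -> square_integrable g ->
    square_integrable h ->
  L2_inner h (fun x => f x - g x) = L2_inner h f - L2_inner h g.
Proof. by move=> *; rewrite L2_innerC L2_innerBl// !(L2_innerC h). Qed.

Lemma L2_inner_suml (I : Type) (s : seq I) (F : I -> T -> R) h :
  (forall i, square_integrable (F i)) -> square_integrable h ->
  L2_inner (fun x => \sum_(i <- s) F i x) h = \sum_(i <- s) L2_inner (F i) h.
Proof.
move=> LF Lh; elim: s => [|i s IHs].
  rewrite big_nil /L2_inner -[RHS](mul0r (fine (mu [set: T]))) -Rintegral_cst//.
  by apply: eq_Rintegral => x _; rewrite big_nil mul0r.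
rewrite big_cons -IHs -L2_innerDl//; last exact: square_integrable_sum.
by apply: eq_Rintegral => x _; rewrite big_cons.
Qed.

Lemma L2_inner_sumr (I : Type) (s : seq I) (F : I -> T -> R) h :
  (forall i, square_integrable (F i)) -> square_integrable h ->
  L2_inner h (fun x => \sum_(i <- s) F i x) = \sum_(i <- s) L2_inner h (F i).
Proof.
move=> LF Lh; rewrite L2_innerC L2_inner_suml//.
by apply: eq_bigr => i _; rewrite L2_innerC.
Qed.

Lemma L2_inner_ge0 f : 0 <= L2_inner f f.
Proof. by apply: Rintegral_ge0 => x _; rewrite -expr2 sqr_ge0. Qed.

(** The polynomial t -> |f - t g|^2 is nonnegative; each case evaluates it at a suitable t. *)
Lemma L2_Cauchy_Schwarz f g : square_integrable f -> square_integrable g ->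
  (L2_inner f g) ^+ 2 <= L2_inner f f * L2_inner g g.
Proof.
move=> Lf Lg.
have expand t : 0 <= L2_inner f f - t * L2_inner f g *+ 2
    + t ^+ 2 * L2_inner g g.
  have Ltg := square_integrableZ t Lg; have Lh := square_integrableB Lf Ltg.
  have := L2_inner_ge0 (fun x => f x - t * g x).
  rewrite (L2_innerBl Lf Ltg Lh) (L2_innerBr Lf Ltg Lf) (L2_innerBr Lf Ltg Ltg).
  rewrite (L2_innerC f (fun x => t * g x)) (L2_innerZl t Lg Lf).
  rewrite (L2_innerZl t Lg Ltg) (L2_innerC g (fun x => t * g x)).
  rewrite (L2_innerZl t Lg Lg) (L2_innerC g f); move=> /le_trans; apply.
  by rewrite le_eqVlt; apply/orP; left; apply/eqP; ring.
have := L2_inner_ge0 g; rewrite le_eqVlt => /orP[/eqP g0|g_gt0].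
  have [->|x0] := eqVneq (L2_inner f g) 0.
    by rewrite expr0n/= mulr_ge0// L2_inner_ge0.
  (* Since <g, g> = 0 the polynomial is affine, and this t gives it the value -1, which is
     absurd. *)
  have := expand ((L2_inner f f + 1) / (L2_inner f g *+ 2)).
  rewrite -g0 mulr0 addr0 -mulrnAr divfK ?mulrn_eq0//.
  by rewrite opprD addrA subrr add0r lerNr oppr0 ler10.
(* This t is the minimiser of the polynomial. *)
have := expand (L2_inner f g / L2_inner g g).
rewrite -(pmulr_lge0 _ g_gt0) => /le_trans; move: g_gt0.
set x := L2_inner f g; set y := L2_inner f f; set z := L2_inner g g => z0.
have zn : z != 0 by rewrite gt_eqF.
rewrite (_ : (y - _ + _) * z = y * z - x ^+ 2); last by field.
by rewrite -subr_ge0; move=> H; exact: H.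
Qed.

(** By Cauchy-Schwarz the square of the inner product is at most a product of squared norms whose
    limit is 0 times c; continuity of the square root then removes the square. *)
Lemma cvg_L2_inner0 (h k : nat -> T -> R) (c : R) :
  (forall n, square_integrable (h n)) -> (forall n, square_integrable (k n)) ->
  L2_inner (h n) (h n) @[n --> \oo] --> 0 ->
  L2_inner (k n) (k n) @[n --> \oo] --> c ->
  L2_inner (h n) (k n) @[n --> \oo] --> 0.
Proof.
move=> Lh Lk h0 kc.
have prod0 : L2_inner (h n) (h n) * L2_inner (k n) (k n) @[n --> \oo] --> (0:R).
  by rewrite -(mul0r c); exact: cvgM.
have sqr0 : (L2_inner (h n) (k n)) ^+ 2 @[n --> \oo] --> (0:R).
  apply: (squeeze_cvgr _ (cvg_cst 0) prod0).
  by near=> n; rewrite sqr_ge0 L2_Cauchy_Schwarz.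
apply: norm_cvg0.
rewrite -(@sqrtr0 R).
under eq_fun do rewrite -sqrtr_sqr.
by apply: continuous_cvg => //; exact: sqrt_continuous.
Unshelve. all: by end_near. Qed.

(** With h = f - f_n and k = g - g_n, one has <f_n, g_n> = <f, g> - <h, g> - <k, f> + <h, k>, and
    the last three terms tend to 0. *)
Lemma cvg_L2_inner (f g : T -> R) (f_ g_ : nat -> T -> R) :
  square_integrable f -> square_integrable g ->
  (forall n, square_integrable (f_ n)) -> (forall n, square_integrable (g_ n)) ->
  (\int[mu]_x ((f x - f_ n x) ^+ 2)%:E)%E @[n --> \oo] --> 0%E ->
  (\int[mu]_x ((g x - g_ n x) ^+ 2)%:E)%E @[n --> \oo] --> 0%E ->
  L2_inner (f_ n) (g_ n) @[n --> \oo] --> L2_inner f g.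
Proof.
move=> Lf Lg Lf_ Lg_ cf cg.
pose h n x := f x - f_ n x; pose k n x := g x - g_ n x.
have Lh n : square_integrable (h n) by exact: square_integrableB.
have Lk n : square_integrable (k n) by exact: square_integrableB.
have h0 : L2_inner (h n) (h n) @[n --> \oo] --> 0.
  exact: fine_cvg cf.
have k0 : L2_inner (k n) (k n) @[n --> \oo] --> 0.
  exact: fine_cvg cg.
have hg : L2_inner (h n) g @[n --> \oo] --> 0.
  exact: (@cvg_L2_inner0 h (fun=> g) (L2_inner g g) Lh _ h0 (cvg_cst _)).
have kf : L2_inner (k n) f @[n --> \oo] --> 0.
  exact: (@cvg_L2_inner0 k (fun=> f) (L2_inner f f) Lk _ k0 (cvg_cst _)).
have hk : L2_inner (h n) (k n) @[n --> \oo] --> 0.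
  exact: (cvg_L2_inner0 Lh Lk h0 k0).
rewrite (_ : (fun n => _) = (fun n => L2_inner f g - L2_inner (h n) g
    - L2_inner (k n) f + L2_inner (h n) (k n))).
  rewrite -[X in _ --> X](_ : L2_inner f g - 0 - 0 + 0 = _); last first.
    by rewrite !subr0 addr0.
  by apply: cvgD => //; apply: cvgB => //; apply: cvgB => //; exact: cvg_cst.
apply/funext => n; rewrite (L2_innerBl Lf (Lf_ n) (Lk n)).
rewrite (L2_innerBl Lf (Lf_ n) Lg) (L2_innerBl Lg (Lg_ n) Lf).
rewrite (L2_innerBr Lg (Lg_ n) Lf) (L2_innerBr Lg (Lg_ n) (Lf_ n)).
by rewrite (L2_innerC (g_ n) f) (L2_innerC g f); ring.
Qed.

End square_integrable_functions.

(** * Second moment of the centred normal law *)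

Section normal_second_moment.
Context {R : realType}.
Notation mu := (@lebesgue_measure R).
Local Open Scope ring_scope.

(** The Radon-Nikodym derivative of [normal_prob 0 s] and the function [normal_pdf 0 s] have the
    same integral over every measurable set, hence agree almost everywhere. *)
Lemma ge0_integral_normal_prob (s : R) (f : R -> R) : (forall x, 0 <= f x) ->
    measurable_fun [set: R] f ->
  (\int[normal_prob 0 s]_x (f x)%:E =
   \int[mu]_x ((f x)%:E * (normal_pdf 0 s x)%:E))%E.
Proof.
move=> f0 mf; have dom := @normal_prob_dominates R 0 s.
rewrite -(Radon_Nikodym_SigmaFinite.change_of_variables dom)//=; last exact/measurable_EFinP.
have mRN : measurable_fun [set: R]
    (Radon_Nikodym_SigmaFinite.f (normal_prob 0 s) mu).
  exact: measurable_int (Radon_Nikodym_SigmaFinite.f_integrable dom).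
have mpdf : measurable_fun [set: R] (fun x => (normal_pdf 0 s x)%:E).
  by apply/measurable_EFinP; exact: measurable_normal_pdf.
apply: ae_eq_integral => //.
- by apply: emeasurable_funM => //; exact/measurable_EFinP.
- by apply: emeasurable_funM => //; exact/measurable_EFinP.
apply: ae_eqe_mul2l; apply: integral_ae_eq => //.
  exact: Radon_Nikodym_SigmaFinite.f_integrable.
by move=> E _ mE; rewrite -Radon_Nikodym_SigmaFinite.f_integral.
Qed.

Lemma is_derive_normal_pdf (s x : R) : s != 0 ->
  is_derive x 1 (normal_pdf 0 s) (- (x / s ^+ 2) * normal_pdf 0 s x).
Proof.
move=> s0; rewrite normal_pdfE// /normal_fun.
apply: is_derive_eq; rewrite /GRing.scale/= !subr0.
by field; rewrite s0.
Qed.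

Lemma cvg_mul_normal_pdf (s : R) : s != 0 ->
  n%:R * normal_pdf 0 s n%:R @[n --> \oo] --> (0 : R).
Proof.
(* Write p for the density and m = n + 1. The bound e^y >= y at y = m^2 / (2 s^2) gives m p(m) <= C
   / m, where C is the peak of p times 2 s^2. *)
move=> s0; pose C := normal_peak s * (s ^+ 2 *+ 2).
have s2 : 0 < s ^+ 2 *+ 2 by rewrite pmulrn_lgt0// exprn_even_gt0.
have C0 : harmonic n * C @[n --> \oo] --> (0 : R).
  by rewrite -(mul0r C); apply: cvgM; [exact: cvg_harmonic|exact: cvg_cst].
rewrite -cvg_shiftS/=; apply: (squeeze_cvgr _ (cvg_cst 0) C0).
near=> n; rewrite mulr_ge0 ?normal_pdf_ge0//=.
rewrite normal_pdfE// /normal_fun subr0 mulNr expRN /C mulrCA.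
rewrite [leRHS]mulrCA ler_pM2l ?normal_peak_gt0//.
set m : R := n.+1%:R; have m0 : 0 < m by rewrite ltr0n.
have := expR_ge1Dx (m ^+ 2 / (s ^+ 2 *+ 2)); set e := expR _ => eD.
rewrite ler_pdivrMr ?expR_gt0// /harmonic/= -/m -mulrA ler_pdivlMl//.
rewrite -expr2 mulrC -ler_pdivrMr//.
by apply: le_trans eD; rewrite lerDr.
Unshelve. all: by end_near. Qed.

(** Since p' = -(x / s^2) p, the integrand is the product of -s^2 x and p', which is integrated by
    parts; the boundary term at 0 vanishes. *)
Lemma integral_sqr_normal_pdf0n (s : R) (n : nat) : s != 0 ->
  (\int[mu]_(x in `[0%R, n.+1%:R]) (x ^+ 2 * normal_pdf 0 s x)%:E =
   (- (s ^+ 2 * (n.+1%:R * normal_pdf 0 s n.+1%:R)))%:E +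
   (s ^+ 2)%:E * \int[mu]_(x in `[0%R, n.+1%:R]) (normal_pdf 0 s x)%:E)%E.
Proof.
move=> s0; set p := normal_pdf 0 s.
have dp (x : R) : is_derive x 1 p (- (x / s ^+ 2) * p x).
  exact: is_derive_normal_pdf.
have cp : continuous p by exact: continuous_normal_pdf.
have ci : continuous (fun x : R => - s ^+ 2 * x) by exact: mulrl_continuous.
have n0 : (0 : R) < n.+1%:R by rewrite ltr0n.
rewrite (_ : (fun x => (x ^+ 2 * p x)%:E) = (fun x =>
    ((- s ^+ 2 * x) * (- (x / s ^+ 2) * p x))%:E)); last first.
  by apply/funext => x; congr EFin; field; rewrite s0.
rewrite (@integration_by_parts _ (fun x => - s ^+ 2 * x) p (fun=> - s ^+ 2)
  (fun x => - (x / s ^+ 2) * p x))//.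
- congr (_ + _)%E; first by rewrite mulr0 mul0r subr0 -mulrA mulNr.
  under eq_integral do rewrite EFinM.
  rewrite integralZl//=; last first.
    apply: continuous_compact_integrable; first exact: segment_compact.
    exact: continuous_subspaceT cp.
  by rewrite EFinN mulNe oppeK.
- by apply: continuous_subspaceT => x; exact: cvg_cst.
- split.
  + by move=> x _; exact: ex_derive.
  + exact/cvg_at_right_filter/ci.
  + exact/cvg_at_left_filter/ci.
- by move=> x _; rewrite derive1E derive_val /GRing.scale/= mulr1.
- apply: continuous_subspaceT => x; apply: cvgM; last exact: cp.
  apply: cvgN; exact: mulrr_continuous.
- split.
  + by move=> x _; have [] := dp x.
  + exact/cvg_at_right_filter/cp.
  + exact/cvg_at_left_filter/cp.
- by move=> x _; rewrite derive1E; have [] := dp x.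
Qed.

(** By parity the half-line suffices. There the integral is the limit of its truncations to
    [0, n+1]: the boundary term tends to 0 and s^2 times the mass of the density remains. *)
Lemma integral_sqr_normal_pdf (s : R) : s != 0 ->
  (\int[mu]_x (x ^+ 2 * normal_pdf 0 s x)%:E = (s ^+ 2)%:E)%E.
Proof.
move=> s0; set p := normal_pdf 0 s.
have p0 x : 0 <= p x by exact: normal_pdf_ge0.
have q0 x : 0 <= x ^+ 2 * p x by rewrite mulr_ge0 ?sqr_ge0.
have cp : continuous p by exact: continuous_normal_pdf.
have cq : continuous (fun x : R => x ^+ 2 * p x).
  by move=> x; apply: cvgM; [exact: sqr_continuous|exact: cp].
have psym : p =1 p \o -%R.
  by move=> x /=; rewrite /p normal_pdfE// /normal_fun !subr0 sqrrN.
have posE : [set x : R | 0 <= x] = `[0, +oo[%classic.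
  by apply/seteqP; split => x/=; rewrite in_itv/= andbT.
have Ip := @integral_normal_pdf R 0 s.
rewrite ge0_symfun_integralT// posE in Ip.
rewrite ge0_symfun_integralT// ?posE; last first.
  by move=> x /=; rewrite sqrrN psym.
suff -> : (\int[mu]_(x in `[0%R, +oo[) (x ^+ 2 * p x)%:E =
    (s ^+ 2)%:E * \int[mu]_(x in `[0%R, +oo[) (p x)%:E)%E.
  by rewrite muleCA Ip mule1.
have mp : measurable_fun setT p by exact: continuous_measurable_fun.
have mq : measurable_fun setT (fun x : R => x ^+ 2 * p x).
  exact: continuous_measurable_fun.
have limp := @ge0_cvgn_integral R mu p p0 mp.
have limq := @ge0_cvgn_integral R mu _ q0 mq.
rewrite -cvg_shiftS/= in limp; rewrite -cvg_shiftS/= in limq.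
apply: (cvg_unique _ limq); first exact: ereal_hausdorff.
rewrite (_ : (fun n => _) = (fun n : nat =>
    (- (s ^+ 2 * (n.+1%:R * p n.+1%:R)))%:E +
    (s ^+ 2)%:E * \int[mu]_(x in `[0%R, n.+1%:R]) (p x)%:E)%E); last first.
  by apply/funext => n; exact: integral_sqr_normal_pdf0n.
rewrite -[((s ^+ 2)%:E * \int[mu]_(x in `[0%R, +oo[) _)%E]add0e.
apply: cvgeD => //; last exact: cvgeZl.
apply: cvg_EFin; first by near=> n.
rewrite -oppr0 -(mulr0 (s ^+ 2)); apply: cvgN; apply: cvgM; first exact: cvg_cst.
by have := cvg_mul_normal_pdf s0; rewrite -cvg_shiftS.
Unshelve. all: by end_near. Qed.

Lemma second_moment_normal_prob (s : R) : s != 0 ->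
  (\int[normal_prob 0 s]_x (x ^+ 2)%:E = (s ^+ 2)%:E)%E.
Proof.
move=> s0; rewrite ge0_integral_normal_prob//; last first.
  by move=> x; exact: sqr_ge0.
by under eq_integral do rewrite -EFinM; exact: integral_sqr_normal_pdf.
Qed.

End normal_second_moment.

(** * Isometry of the Wiener integral *)

Section wiener_isometry.
Context {d : measure_display} {T : measurableType d} {R : realType}.
Variables (P : probability T R) (W : R -> {RV P >-> R}).
Hypothesis hW : two_sided_wiener W.
Notation lambda := (@lebesgue_measure R).
Implicit Types (a b c e s t : R) (p q : step R) (l : seq (step R)).

Lemma wiener_increment_second_moment_lt s t : s < t ->
  (\int[P]_w ((W t w - W s w) ^+ 2)%:E = (t - s)%:E)%E.
Proof.
move=> st; have [_ _ + _] := hW => /(_ s t st) law.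
pose X (w : T) : measurableTypeR R := W t w - W s w.
have mX : measurable_fun [set: T] X.
  by apply: (measurable_funB (f := W t) (g := W s)).
pose mX_mixin := isMeasurableFun.Build _ _ _ _ _ mX.
pose X' : {mfun T >-> measurableTypeR R} := HB.pack X mX_mixin.
have msqr : measurable_fun [set: measurableTypeR R] (fun x : R => (x ^+ 2)%:E).
  exact/measurable_EFinP/measurable_funX.
transitivity (\int[pushforward P X]_x (x ^+ 2)%:E)%E.
  rewrite ge0_integral_pushforward//.
  by move=> x _; rewrite lee_fin sqr_ge0.
transitivity (\int[normal_prob 0 (Num.sqrt (t - s))]_x (x ^+ 2)%:E)%E.
  apply: (eq_measure_integral (normal_prob 0 (Num.sqrt (t - s)))
            (m1 := pushforward P X')) => A mA _.
  exact: law.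
have ts0 : 0 < t - s by rewrite subr_gt0.
by rewrite second_moment_normal_prob ?gt_eqF ?sqrtr_gt0// sqr_sqrtr// ltW.
Qed.

(** The absolute value allows both orders of the times, as the polarisation below pairs endpoints of
    two intervals in unknown relative position. *)
Lemma wiener_increment_second_moment s t :
  (\int[P]_w ((W t w - W s w) ^+ 2)%:E = `|t - s|%:E)%E.
Proof.
have [st|ts|->] := ltgtP s t.
- rewrite wiener_increment_second_moment_lt// gtr0_norm// subr_gt0//.
- under eq_integral do rewrite -sqrrN opprB.
  by rewrite wiener_increment_second_moment_lt// ltr0_norm ?subr_lt0// opprB.
- under eq_integral do rewrite subrr expr0n.
  by rewrite integral0 subrr normr0.
Qed.

Lemma square_integrable_increment s t :
  square_integrable P (fun w => W t w - W s w).
Proof.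
split; first exact: measurable_funB.
by rewrite wiener_increment_second_moment ltry.
Qed.

(* Twice the product of two increments is a signed sum of four squared
   increments, so the covariances follow from the variances alone. *)
Lemma L2_inner_increments a b c e :
  L2_inner P (fun w => W b w - W a w) (fun w => W e w - W c w) =
  (`|b - c| + `|a - e| - `|b - e| - `|a - c|) / 2.
Proof.
have Isqr s t : P.-integrable [set: T] (EFin \o (fun w => (W t w - W s w) ^+ 2)).
  by have [] := (square_integrableP P _).1 (square_integrable_increment s t).
have Ival s t : \int[P]_w ((W t w - W s w) ^+ 2) = `|t - s|.
  by rewrite /Rintegral wiener_increment_second_moment.
rewrite /L2_inner (_ : Rintegral _ _ _ = \int[P]_w (2^-1 *
  ((W b w - W c w) ^+ 2 + (W a w - W e w) ^+ 2 - (W b w - W e w) ^+ 2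
   - (W a w - W c w) ^+ 2))); last first.
  by apply: eq_Rintegral => w _; field.
have I2 : P.-integrable [set: T] (EFin \o (fun w =>
    (W b w - W c w) ^+ 2 + (W a w - W e w) ^+ 2)).
  exact: (integrableD measurableT (Isqr _ _) (Isqr _ _)).
have I3 : P.-integrable [set: T] (EFin \o (fun w =>
    (W b w - W c w) ^+ 2 + (W a w - W e w) ^+ 2 - (W b w - W e w) ^+ 2)).
  exact: (integrableB measurableT I2 (Isqr _ _)).
rewrite RintegralZl//; last exact: (integrableB measurableT I3 (Isqr _ _)).
by rewrite !RintegralB// RintegralD// !Ival mulrC.
Qed.

Lemma square_integrable_indic_itv a b :
  square_integrable lambda (\1_(`]a, b])).
Proof.
split; first exact: measurable_indic.
rewrite (_ : (fun x => _) = (fun x => (\1_(`]a, b] : set R) x)%:E)); last first.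
  by apply/funext => x; rewrite indicE; case: (_ \in _); rewrite ?expr1n ?expr0n.
rewrite integral_indic// setIT/= lebesgue_measure_itv/=.
by case: ifP => _; rewrite ?ltry// -EFinD ltry.
Qed.

(** Both sides are the length of the overlap of the two intervals. It is put in the form found for
    the covariance of increments, so that step functions and their integrals match pair by pair. *)
Lemma L2_inner_indic_itv a b c e : a <= b -> c <= e ->
  L2_inner lambda (\1_(`]a, b])) (\1_(`]c, e])) =
  (`|b - c| + `|a - e| - `|b - e| - `|a - c|) / 2.
Proof.
move=> ab ce; rewrite /L2_inner /Rintegral.
rewrite (_ : (fun x => _) =
    (fun x => (\1_(`]Num.max a c, Num.min b e] : set R) x)%:E)); last first.
  apply/funext => x; congr EFin; rewrite !indicE -natrM mulnb -in_setI.
  congr ((_ \in _)%:R); apply/seteqP; split => y /=; rewrite !in_itv/=.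
    by rewrite gt_max le_min => -[/andP[-> ->] /andP[-> ->]].
  by rewrite gt_max le_min => /andP[/andP[-> ->] /andP[-> ->]].
rewrite integral_indic// setIT/= lebesgue_measure_itv/= lte_fin.
have -> : fine (if (Num.max a c < Num.min b e)%R then
    (Num.min b e)%:E - (Num.max a c)%:E else 0)%E =
    if Num.max a c < Num.min b e then Num.min b e - Num.max a c else 0.
  by case: ifP.
(* Both sides are piecewise linear in the endpoints; fixing every comparison leaves linear
   arithmetic. *)
case: (leP a c) => h1; case: (leP b e) => h2; case: ltP => h3;
  case: (ger0P (b - c)) => h4; case: (ger0P (a - e)) => h5;
  case: (ger0P (b - e)) => h6; case: (ger0P (a - c)) => h7; lra.
Qed.

Lemma square_integrable_step_fun l : square_integrable lambda (step_fun l).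
Proof.
apply: square_integrable_sum => p.
exact/square_integrableZ/square_integrable_indic_itv.
Qed.

Lemma square_integrable_step_integral l :
  square_integrable P (step_integral (fun t => W t) l).
Proof.
apply: square_integrable_sum => p.
exact/square_integrableZ/square_integrable_increment.
Qed.

(** Bilinearity reduces the claim to one pair of steps; [step_le] supplies the order of endpoints
    that the indicators require. *)
Lemma L2_inner_step_integral l l' :
  L2_inner P (step_integral (fun t => W t) l) (step_integral (fun t => W t) l') =
  L2_inner lambda (step_fun l) (step_fun l').
Proof.
have Linc p := square_integrable_increment (step_left p) (step_right p).
have Lind p := square_integrable_indic_itv (step_left p) (step_right p).
have LincZ p := square_integrableZ (step_height p) (Linc p).
have LindZ p := square_integrableZ (step_height p) (Lind p).
rewrite (L2_inner_suml l LincZ (square_integrable_step_integral l')).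
rewrite (L2_inner_suml l LindZ (square_integrable_step_fun l')).
apply: eq_bigr => p _; rewrite (L2_inner_sumr l' LincZ (LincZ p)).
rewrite (L2_inner_sumr l' LindZ (LindZ p)); apply: eq_bigr => q _.
rewrite (L2_innerZl _ (Linc p) (LincZ q)) (L2_innerZl _ (Lind p) (LindZ q)).
congr (_ * _); rewrite L2_innerC (L2_innerZl _ (Linc q) (Linc p)).
rewrite [RHS]L2_innerC (L2_innerZl _ (Lind q) (Lind p)); congr (_ * _).
by rewrite L2_inner_increments L2_inner_indic_itv//; exact: step_le.
Qed.

(** A mean-square error tending to 0 is finite from some index N on, and X is the sum of the N-th
    error and the N-th step integral, both square integrable. *)
Lemma square_integrable_wiener_integral (f : R -> R) (X : {RV P >-> R}) :
  is_wiener_integral W f X -> square_integrable P X.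
Proof.
move=> [_ [l [_]]]; rewrite unlock => /fine_cvgP[[N _ fin] _].
have /= := fin N (leqnn N); set I := step_integral _ (l N) => finN.
have LI : square_integrable P I by exact: square_integrable_step_integral.
have LXI : square_integrable P (fun w => X w - I w).
  split; last by rewrite -ge0_fin_numE// integral_ge0// => w _; rewrite lee_fin sqr_ge0.
  by apply: measurable_funB => //; have [] := LI.
have := square_integrableD LXI LI.
by under eq_fun do rewrite subrK.
Qed.

(** Both inner products are limits of one real sequence, the inner products of the approximating
    step functions. *)
Lemma wiener_isometry (f g : R -> R) (X Y : {RV P >-> R}) :
  is_wiener_integral W f X -> is_wiener_integral W g Y ->
  L2_inner P X Y = L2_inner lambda f g.
Proof.
move=> fX gY.
have LX := square_integrable_wiener_integral fX.
have LY := square_integrable_wiener_integral gY.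
move: fX gY => [L2f [l [fl Xl]]] [L2g [l' [gl' Yl']]].
have Lf : square_integrable lambda f := L2f.
have Lg : square_integrable lambda g := L2g.
rewrite unlock in Xl; rewrite unlock in Yl'.
have cvgXY := cvg_L2_inner LX LY (fun n => square_integrable_step_integral (l n))
  (fun n => square_integrable_step_integral (l' n)) Xl Yl'.
have cvgfg := cvg_L2_inner Lf Lg (fun n => square_integrable_step_fun (l n))
  (fun n => square_integrable_step_fun (l' n)) fl gl'.
apply: (cvg_unique _ cvgXY) => //; apply: cvg_trans cvgfg.
by apply: near_eq_cvg; near=> n; rewrite L2_inner_step_integral.
Unshelve. all: by end_near. Qed.

End wiener_isometry.

(** * Positivity of [kappa] and lower bounds for the kernels *)

Section sonine_kernel.
Context {R : realType}.
Variable kappa : R -> R.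
Notation lambda := (@lebesgue_measure R).
Hypothesis kappa_ge0 : forall x : R, 0 < x -> 0 <= kappa x.
Hypothesis kappa_noninc : forall x y : R, 0 < x -> x <= y -> kappa y <= kappa x.
Hypothesis kappa_L1 : forall eps : R, 0 < eps -> in_L1 `]0, eps[ kappa.

Lemma kappa_gt0 (phi : R -> R) :
  phi theta @[theta --> 0^'+] --> (0 : R) ->
  phi theta / theta @[theta --> 0^'+] --> +oo ->
  (forall theta : R, 0 < theta -> laplace kappa theta = ((phi theta)^-1)%:E) ->
  forall x : R, 0 < x -> 0 < kappa x.
Proof.
move=> phi0 phi_div0 kappa_laplace x x0.
rewrite lt_neqAle kappa_ge0// andbT; apply/negP => /eqP kx0.
have ky0 y : x <= y -> kappa y = 0.
  move=> xy; apply/eqP; rewrite eq_le kappa_ge0 ?(lt_le_trans x0)// andbT.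
  by rewrite [leRHS]kx0 kappa_noninc.
pose M := \int[lambda]_(y in `]0, x[) kappa y.
(* As [kappa] vanishes from x on, the Laplace integral lives on (0, x), where the exponential is at
   most 1. *)
have bounded theta : 0 < theta -> (phi theta)^-1 <= M.
  move=> th0; rewrite -lee_fin -kappa_laplace// /laplace.
  rewrite (_ : integral _ _ _ = \int[lambda]_(y in `]0%R, x[)
      (expR (- (y * theta)) * kappa y)%:E)%E; last first.
    rewrite integral_mkcond [RHS]integral_mkcond; apply: eq_integral => y _.
    rewrite !patchE !mem_setE !in_itv/= andbT.
    case: (ltP 0 y) => //= y0; case: (ltP y x) => // xy.
    by rewrite ky0// mulr0.
  have /integrableP[mk _] := kappa_L1 x0.
  rewrite /M /Rintegral fineK; last exact: integrable_fin_num (kappa_L1 x0).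
  apply: ge0_le_integral => //=.
  - move=> y; rewrite in_itv/= => /andP[y0 _].
    by rewrite lee_fin mulr_ge0 ?expR_ge0 ?kappa_ge0.
  - apply/measurable_EFinP/measurable_funM; last exact/measurable_EFinP.
    apply: measurable_funTS; apply: measurableT_comp => //.
    apply: measurableT_comp => //; exact: measurable_funM.
  - move=> y; rewrite in_itv/= => /andP[y0 _].
    rewrite lee_fin ler_piMl ?kappa_ge0// -expR0 ler_expR oppr_le0.
    by rewrite mulr_ge0// ltW.
(* Adding 1 makes the bound strictly positive even when M = 0, so that it can be inverted. *)
have M1 : 0 < M + 1.
  by rewrite ltr_wpDl// Rintegral_ge0// => y /=; rewrite in_itv/= => /andP[/kappa_ge0].
near (0 : R)^'+ => theta.
have th0 : 0 < theta by [].
(* The sign comes from [phi_div0]; it is what makes the inverse of a small [phi theta] large. *)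
have ph0 : 0 < phi theta.
  rewrite -(pmulr_lgt0 _ (x := theta^-1)) ?invr_gt0//.
  by near: theta; exact: (cvgryPgt _).1.
have phM : phi theta < (M + 1)^-1.
  by near: theta; apply: (cvgr_lt _ phi0); rewrite invr_gt0.
have := bounded theta th0; rewrite leNgt => /negP; apply.
apply: (@lt_trans _ _ (M + 1)); first by rewrite ltrDl.
by rewrite -[ltLHS]invrK ltf_pV2// posrE invr_gt0.
Unshelve. all: by end_near. Qed.

(** By monotonicity, [kappa y] bounds [kappa] from below on (x, y). *)
Lemma chiB_ge (x y : R) : 0 <= x -> x <= y ->
  (y - x) * kappa y <= chi kappa y - chi kappa x.
Proof.
move=> x0; rewrite le_eqVlt => /predU1P[<-|xy]; first by rewrite !subrr mul0r.
have y0 : 0 < y by exact: le_lt_trans xy.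
have Iy : lambda.-integrable `]0, y[ (EFin \o kappa) by exact: kappa_L1.
have Ix : lambda.-integrable `]0, x[ (EFin \o kappa).
  by apply: integrableS Iy => //; apply: subset_itvl; rewrite bnd_simp ltW.
have Ixy : lambda.-integrable `]x, y[ (EFin \o kappa).
  by apply: integrableS Iy => //; apply: subset_itvr; rewrite bnd_simp.
(* Closing the right end of ]0, x[ changes a null set and makes the difference of the domains
   exactly ]x, y[. *)
rewrite /chi (Rintegral_itv_bndo_bndc Ix) Rintegral_itvB//.
have xyE : lambda `]x, y[ = (y - x)%:E.
  by rewrite lebesgue_measure_itv/= lte_fin xy.
rewrite (_ : (y - x) * kappa y = \int[lambda]_(z in `]x, y[) kappa y); last first.
  by rewrite Rintegral_cst//= xyE mulrC.
apply: le_Rintegral => //.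
- apply/integrableP; split; first exact: measurable_cst.
  by rewrite integral_cst//= xyE -EFinM ltry.
- move=> z /=; rewrite in_itv/= => /andP[xz zy].
  by rewrite kappa_noninc ?(le_lt_trans x0)// ltW.
Qed.

Lemma chi_le (x y : R) : 0 <= x -> x <= y -> chi kappa x <= chi kappa y.
Proof.
move=> x0 xy; rewrite -subr_ge0.
(* The case y = x is set apart because it contains y = 0, where the sign of [kappa] is unknown. *)
have [->|y0] := eqVneq y x; first by rewrite subrr.
apply: le_trans (chiB_ge x0 xy); rewrite mulr_ge0 ?subr_ge0// kappa_ge0//.
by rewrite (le_lt_trans x0)// lt_neqAle eq_sym y0.
Qed.

Lemma kernel_kappa_le (s t u : R) : s <= t ->
  kernel_kappa kappa s u <= kernel_kappa kappa t u.
Proof.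
move=> st; rewrite /kernel_kappa lerD2r chi_le//; first by rewrite le_max lexx orbT.
by rewrite ge_max !le_max lexx orbT lerD2r st.
Qed.

Lemma kernel_kappa0 (u : R) : kernel_kappa kappa 0 u = 0.
Proof. by rewrite /kernel_kappa sub0r subrr. Qed.

Lemma kernel_kappa_ge0 (t u : R) : 0 <= t -> 0 <= kernel_kappa kappa t u.
Proof. by move=> t0; rewrite -(kernel_kappa0 u) kernel_kappa_le. Qed.

(** Here -u is negative and 1 - u >= 1/2, so the kernel is at least chi(1/2) - chi(0), to which
    [chiB_ge] applies. *)
Lemma kernel_kappa1_ge (u : R) : 0 < u -> u <= 2^-1 ->
  2^-1 * kappa 2^-1 <= kernel_kappa kappa 1 u.
Proof.
move=> u0 u2; rewrite /kernel_kappa max_l; last by lra.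
rewrite max_r; last by lra.
have h0 : 0 <= 2^-1 :> R by lra.
have := chiB_ge (lexx 0) h0; rewrite subr0 => /le_trans; apply.
by rewrite lerD2r chi_le//; lra.
Qed.

(** The terms in -u cancel, leaving the increment of chi from n - u to n + 1 - u, an interval of
    length 1. It is at least kappa(n + 1 - u), hence at least kappa(n + 1). *)
Lemma kernel_kappaS_ge (n : nat) (u : R) : (0 < n)%N -> 0 < u -> u <= 2^-1 ->
  kappa n.+1%:R <= kernel_kappa kappa n.+1%:R u - kernel_kappa kappa n%:R u.
Proof.
move=> n0 u0 u2; have n1 : 1 <= n%:R :> R by rewrite ler1n.
rewrite /kernel_kappa opprB addrA subrK -natr1.
rewrite max_l; last by lra.
rewrite max_l; last by lra.
apply: le_trans (chiB_ge _ _); [|lra|lra].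
rewrite (_ : n%:R + 1 - u - (n%:R - u) = 1) ?mul1r; last by ring.
by apply: kappa_noninc; lra.
Qed.

End sonine_kernel.

(** The function dominates c times the indicator of ]a, b], whose integral is c (b - a). *)
Lemma Rintegral_gt0_itv (R : realType) (f : R -> R) (a b c : R) :
  lebesgue_measure.-integrable [set: R] (EFin \o f) ->
  (forall x, 0 <= f x) -> a < b -> 0 < c -> (forall x, a < x -> x <= b -> c <= f x) ->
  0 < \int[lebesgue_measure]_x f x.
Proof.
move=> If f0 ab c0 cf.
have Iab : lebesgue_measure.-integrable [set: R]
    (fun x => (\1_(`]a, b] : set R) x)%:E).
  exact: integrable_indic_itv.
apply: (@lt_le_trans _ _ (\int[lebesgue_measure]_x (c * \1_(`]a, b] : set R) x))).
  rewrite RintegralZl// mulr_gt0// /Rintegral integral_indic// setIT/=.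
  by rewrite lebesgue_measure_itv/= lte_fin ab /= subr_gt0.
apply: le_Rintegral => //.
  by rewrite (_ : _ \o _ = (fun x => c%:E * (\1_(`]a, b] : set R) x)%:E)%E);
    first exact: integrableZl.
move=> x _; rewrite indicE; case: (boolP (x \in _)) => [|_].
  by rewrite inE/= in_itv/= mulr1 => /andP[ax xb]; exact: cf.
by rewrite mulr0.
Qed.

(** * Positivity of the correlations *)

Unset Implicit Arguments.

Theorem theorem5p2 (R : realType) (d : measure_display) (T : measurableType d)
    (P : probability T R) (W : R -> {RV P >-> R}) (hW : two_sided_wiener W)
    (phi nu kappa : R -> R)
    (hnu : levy_density nu) (hnu_cm : completely_monotone nu)
    (hphi_cb : complete_bernstein phi)
    (hphi : forall x : R, 0 < x -> (phi x)%:E = bernstein_integral nu x)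
    (hphi_0 : phi theta @[theta --> 0^'+] --> (0 : R))
    (hphi_oo : phi theta @[theta --> +oo] --> +oo)
    (hphi_div_0 : phi theta / theta @[theta --> 0^'+] --> +oo)
    (hphi_div_oo : phi theta / theta @[theta --> +oo] --> (0 : R))
    (hkappa_ge0 : forall x : R, 0 < x -> 0 <= kappa x)
    (hkappa_loc : locally_integrable `]0, +oo[ kappa)
    (hkappa_noninc : forall x y : R, 0 < x -> x <= y -> kappa y <= kappa x)
    (hkappa : forall theta : R, 0 < theta ->
       laplace kappa theta = ((phi theta)^-1)%:E)
    (hkappa_L : forall eps : R, 0 < eps ->
       in_L1 `]0, eps[ kappa /\ in_L2 `]eps, +oo[ kappa)
    (hchi_L2 : forall eps : R, 0 < eps -> in_L2 `]0, eps[ (chi kappa))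
    (B : R -> {RV P >-> R}) (hB : is_B_kappa W kappa B) :
  persistent B.
Proof.
move=> n n_ge1.
have kappa_L1 (eps : R) : 0 < eps -> in_L1 `]0, eps[ kappa.
  by move=> /hkappa_L[].
have kappa_pos := kappa_gt0 hkappa_ge0 hkappa_noninc kappa_L1 hphi_0 hphi_div_0
  hkappa.
have [X1 [WX1 BX1]] := hB 1 ler01.
have [Xn [WXn BXn]] := hB _ (ler0n R n).
have [XS [WXS BXS]] := hB _ (ler0n R n.+1).
have L1 : square_integrable lebesgue_measure (kernel_kappa kappa 1) := WX1.1.
have Ln : square_integrable lebesgue_measure (kernel_kappa kappa n%:R) := WXn.1.
have LS : square_integrable lebesgue_measure (kernel_kappa kappa n.+1%:R) :=
  WXS.1.
have LX1 := square_integrable_wiener_integral hW WX1.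
have LXn := square_integrable_wiener_integral hW WXn.
have LXS := square_integrable_wiener_integral hW WXS.
have half_gt0 : (0 : R) < 2^-1 by rewrite invr_gt0.
(* The inverse of 0 is 0 by convention, so the integral inside [C_kappa] must be shown positive; the
   squared kernel is bounded below on (0, 1/2]. *)
have C_gt0 : 0 < C_kappa kappa.
  rewrite /C_kappa invr_gt0.
  apply: (@Rintegral_gt0_itv _ _ 0 2^-1 ((2^-1 * kappa 2^-1) ^+ 2)) => //.
  - exact: ((square_integrableP _ _).1 L1).2.
  - by move=> u; exact: sqr_ge0.
  - by rewrite exprn_gt0// mulr_gt0// kappa_pos.
  - move=> u u0 u2; rewrite ler_sqr ?nnegrE.
    + exact: kernel_kappa1_ge.
    + by rewrite mulr_ge0 ?ltW// kappa_pos.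
    + exact: kernel_kappa_ge0.
pose K u := kernel_kappa kappa n.+1%:R u - kernel_kappa kappa n%:R u.
have LK : square_integrable lebesgue_measure K := square_integrableB LS Ln.
(* Both factors are nonnegative everywhere, and on (0, 1/2] their lower bounds multiply to the
   constant given here. *)
have inner_gt0 : 0 < L2_inner lebesgue_measure (kernel_kappa kappa 1) K.
  apply: (@Rintegral_gt0_itv _ _ 0 2^-1
    (2^-1 * kappa 2^-1 * kappa n.+1%:R)) => //.
  - exact: (square_integrableM L1 LK).
  - move=> u; rewrite mulr_ge0//; first exact: kernel_kappa_ge0.
    by rewrite subr_ge0 kernel_kappa_le// ler_nat.
  - by rewrite !mulr_gt0// kappa_pos.
  - move=> u u0 u2; apply: ler_pM.
    + by rewrite mulr_ge0 ?ltW// kappa_pos.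
    + by rewrite ltW// kappa_pos.
    + exact: kernel_kappa1_ge.
    + exact: kernel_kappaS_ge.
have LXB := square_integrableB LXS LXn.
have IX := square_integrableM LX1 LXB.
(* Almost surely each B is the square root of [C_kappa] times its Wiener integral, and the two
   square roots multiply to [C_kappa]. *)
have -> : rho B n =
    (\int[P]_w ((C_kappa kappa)%:E * (X1 w * (XS w - Xn w))%:E))%E.
  rewrite /rho unlock; apply: ae_eq_integral => //.
  - apply/measurable_EFinP/measurable_funM => //; exact: measurable_funB.
  - apply/measurable_EFinP/measurable_funM => //; apply: measurable_funM => //.
    exact: measurable_funB.
  - apply: filterS3 BX1 BXn BXS => w B1E BnE BSE _; rewrite B1E BnE BSE.
    by rewrite -EFinM -mulrBr mulrACA -expr2 sqr_sqrtr// ltW.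
rewrite integralZl// -[X in (_ * X)%E]fineK; last exact: integrable_fin_num.
rewrite -EFinM lte_fin mulr_gt0//.
rewrite -/(Rintegral P setT (fun w => X1 w * (XS w - Xn w))).
rewrite -/(L2_inner P X1 (fun w => XS w - Xn w)) L2_innerBr//.
(* The isometry is applied to [XS] and [Xn] separately; linearity on both sides then recovers the
   inner product with [K]. *)
rewrite (wiener_isometry hW WX1 WXS) (wiener_isometry hW WX1 WXn).
rewrite -(L2_innerBr LS Ln L1); exact: inner_gt0.
Qed.
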